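(* Let $M$ be a partially ordered monoid with a family of null sequences $Z(M)$, and let $(X,d_{X,M},Z(M))$ be a Hausdorff equipped dislocated $M$-distance space, where $X$ is a partially ordered set and $Z(M)$-convergence in $X$ is regular. Let $f\colon X\to X$ be non-decreasing and orbitally semi-continuous. Let $\{\lambda_n\}_{n\in\mathbb{N}}$ be a sequence of non-decreasing operators $\lambda_n\colon M_+\to M_+$ and put $\Lambda_n:=\lambda_n\circ\lambda_{n-1}\circ\dots\circ\lambda_1$. Assume that there exists $x_0\in X$ such that $x_0\le f(x_0)$ and one of the following sets of conditions (I) or (II) holds: (I) (a) $(X,d_{X,M},Z(M))$ is $\mathcal{H}$-complete; (b) the orbit $O(f,x_0)$ is bounded; (c) for any $\alpha\in M_+$ one has $\{\Lambda_n(\alpha)\}\in Z(M)$; (d) for each $n\in\mathbb{N}$ and $x,y\in O_n(f,x_0)$ there exist $x',y'\in O_{n-1}(f,x_0)$ such that $d_{X,M}(x,y)\le\lambda_n(d_{X,M}(x',y'))$. (II) (a) $(X,d_{X,M},Z(M))$ is $\mathcal{W}$-complete; (b) for any $n\in\mathbb{N}$, $d_{X,M}(f^n(x_0),f^{n+1}(x_0))\le\lambda_n(d_{X,M}(f^{n-1}(x_0),f^n(x_0)))$; (c) $\{\Lambda_n(d_{X,M}(x_0,f(x_0)))\}\in\mathcal{CS}$. Then $f$ has at least one fixed point, which is the limit of the sequence $\{x_n=f(x_{n-1})\}_{n\ge1}$. The fixed point is unique, provided the following set of conditions (III) holds: (III) (a) for any $\alpha\in M_+$ one has $\{\Lambda_n(\alpha)\}\in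 Z(M)$; (b) for arbitrary $u,v\in X$, each $n\in\mathbb{N}$ and arbitrary $x\in O_n(f,u)$, $y\in O_n(f,v)$, there exist $x'\in O_{n-1}(f,u)$ and $y'\in O_{n-1}(f,v)$ such that $d_{X,M}(x,y)\le\lambda_n(d_{X,M}(x',y'))$; (c) for arbitrary $u,v\in X$ the set $\{d_{X,M}(x,y): x\in O(f,u),\ y\in O(f,v)\}$ is bounded. If $X$ satisfies the Riesz property, then for uniqueness it is enough to require (III)(a) and that (III)(b) and (III)(c) hold only for those $u,v\in X$ whose orbits $O(f,u)$ and $O(f,v)$ have pairwise comparable elements (every element of $O(f,u)$ is comparable with every element of $O(f,v)$).
   Context: A partially ordered monoid is a monoid $(M,+,\theta_M)$ (associative operation $+$, neutral element $\theta_M$; not assumed commutative) with a partial order $\le$ such that $x_1\le y_1$, $x_2\le y_2$ imply $x_1+x_2\le y_1+y_2$, and $M_+:=\{x\in M:\theta_M\le x\}\ne\{\theta_M\}$. A set $N\subset M_+$ is bounded if there is $m\in M$ with $n\le m$ for all $n\in N$. A family of null sequences $Z(M)$ is a family of sequences of elements of $M_+$ such that: (1) the constant sequence $\{\theta_M\}$ is in $Z(M)$, and if $x\in M_+$ and the constant sequence $\{x\}$ is in $Z(M)$ then $x=\theta_M$; (2) $\{x_n\},\{y_n\}\in Z(M)$ implies $\{x_n+y_n\}\in Z(M)$; (3) if $\{x_n\}\in Z(M)$ and $\theta_M\le y_n\le x_n$ for all $n$, then $\{y_n\}\in Z(M)$; (4) each subsequence of a sequence in $Z(M)$ is in $Z(M)$.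 $\mathcal{CS}$ denotes the set of sequences $\{x_n\}$ in $M_+$ whose series is a Cauchy series, i.e. for all increasing sequences of natural numbers $\{n_k\},\{m_k\}$ with $m_k\ge n_k$ for all $k$ one has $\{\sum_{s=n_k}^{m_k}x_s\}_k\in Z(M)$. A dislocated $M$-valued distance on a set $X$ is a mapping $d_{X,M}\colon X\times X\to M_+$ with $d_{X,M}(x,y)=d_{X,M}(y,x)$ for all $x,y$ and such that $d_{X,M}(x,y)=\theta_M$ implies $x=y$. Together with a chosen family $Z(M)$ it forms an equipped dislocated $M$-distance space $(X,d_{X,M},Z(M))$. A sequence $\{x_n\}\subset X$ converges to $x\in X$ ($x_n\to x$) if $\{d_{X,M}(x_n,x)\}\in Z(M)$. The space is Hausdorff if each converging sequence has a unique limit. A sequence $\{x_n\}\subset X$ is Cauchy if for all increasing sequences of natural numbers $\{n_k\},\{m_k\}$ with $m_k>n_k$ for all $k$ one has $\{d_{X,M}(x_{n_k},x_{m_k})\}\in Z(M)$; the space is $\mathcal{H}$-complete if each Cauchy sequence converges to an element of $X$. $\mathcal{CW}$ is the family of sequences $\{x_n\}\subset X$ with $\{d_{X,M}(x_n,x_{n+1})\}\in\mathcal{CS}$; the space is $\mathcal{W}$-complete if each sequence in $\mathcal{CW}$ converges to an element of $X$. $f^n$ is the $n$-th iterate of $f$, $f^0=\mathrm{id}$. $O_n(f,x_0):=\{f^n(x_0),f^{n+1}(x_0),\dots\}$ for $n\ge0$ and $O(f,x_0):=O_0(f,x_0)$. The orbit $O(f,x_0)$ is bounded if the set $\{d_{X,M}(f^n(x_0),f^m(x_0)):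 n,m\ge0\}$ is bounded. A map $g$ between partially ordered sets is non-decreasing if $a\le b$ implies $g(a)\le g(b)$. For $X$ partially ordered by $\le$: $Z(M)$-convergence is regular if (1) for each non-decreasing sequence $\{x_n\}$ converging to $x$ one has $x_n\le x$ for all $n$; (2) for each non-decreasing sequence $\{x_n\}$ with $x_n\to x$ and $x_n\le y$ for all $n$, one has $x\le y$. A function $f\colon X\to X$ is orbitally semi-continuous if for each $z\in X$ such that $\{f^n(z)\}$ converges to some $x\in X$ one has $f(x)\le x$. $X$ satisfies the Riesz property if every pair $x,y\in X$ has a supremum $x\vee y\in X$. *)

(* Defs.v *)
From HB Require Import structures.
From mathcomp Require Import all_boot all_order.
From mathcomp Require Import boolp classical_sets.

Set Warnings "-notation-overridden,-redundant-canonical-projection,-projection-no-head-constant".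
Set Implicit Arguments.
Unset Strict Implicit.
Unset Printing Implicit Defensive.

Import Order.TTheory.
Local Open Scope classical_set_scope.
Local Open Scope group_scope.
Local Open Scope order_scope.

(* The additive monoids of MathComp are commutative, so a partially ordered    *)
(* monoid (M, +, theta_M) is a multiplicatively written [monoidType]: [x * y]  *)
(* stands for x + y, [1] for theta_M, and [\prod] for an (ordered) finite sum. *)
HB.mixin Record Monoid_POrder_isPOMonoid (disp : Order.disp_t) M
    of Monoid M & Order.POrder disp M := {
  lem_mulg : forall x1 y1 x2 y2 : M,
    x1 <= y1 -> x2 <= y2 -> (x1 * x2)%g <= (y1 * y2)%g;
  pos_nontrivial : exists x : M, (1%g : M) <= x /\ x <> 1%g
}.

#[short(type="poMonoidType")]
HB.structure Definition POMonoid (disp : Order.disp_t) :=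
  {M of Monoid_POrder_isPOMonoid disp M & Monoid M & Order.POrder disp M}.

Section PositiveCone.
Context {disp : Order.disp_t} (M : poMonoidType disp).

Definition pos_pred : pred M := fun x => (1%g : M) <= x.

(* M_+ as a type: it inherits the order and the monoid structure of M. *)
Record pos := Pos { pos_val :> M; _ : pos_pred pos_val }.

HB.instance Definition _ := [isSub for pos_val].
HB.instance Definition _ := [Choice of pos by <:].
HB.instance Definition _ := [SubChoice_isSubPOrder of pos by <: with disp].

Lemma pos_monoid_closed : monoid_closed pos_pred.
Proof.
split=> [|x y x_ge1 y_ge1]; first exact: lexx.
by rewrite unfold_in /pos_pred -[leLHS](mul1g 1%g); apply: lem_mulg.
Qed.

HB.instance Definition _ :=
  SubChoice_isSubMonoid.Build M pos_pred pos pos_monoid_closed.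

Definition bounded (N : set pos) := has_ubound [set (a : M) | a in N].

End PositiveCone.

(* Sequences (u_n)_{n in N} are functions on [nat], whose index 0 carries the  *)
(* first term; a sequence given by a formula for n = 1, 2, ... is therefore    *)
(* written [fun n => E n.+1].                                                  *)
Definition increasing (n_ : nat -> nat) := {homo n_ : i j / (i < j)%N}.

Definition nondecreasing_sequence {disp : Order.disp_t} {X : porderType disp}
  (xs : nat -> X) := {homo xs : m n / (m <= n)%N >-> m <= n}.

Section NullSequences.
Context {disp : Order.disp_t} {M : poMonoidType disp}.
Implicit Types (Z : set (nat -> pos M)) (xs ys : nat -> pos M) (x : pos M).

Record null_family Z : Prop := {
  null_cst : Z (fun=> 1%g);
  null_cst_eq : forall x, Z (fun=> x) -> x = 1%g;
  null_mul : forall xs ys, Z xs -> Z ys -> Z (fun n => (xs n * ys n)%g);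
  null_le : forall xs ys, Z xs -> (forall n, ys n <= xs n) -> Z ys;
  null_subseq : forall xs n_, Z xs -> increasing n_ -> Z (xs \o n_)
}.

Definition cauchy_series Z : set (nat -> pos M) :=
  [set xs | forall n_ m_ : nat -> nat, increasing n_ -> increasing m_ ->
    (forall k, (n_ k <= m_ k)%N) ->
    Z (fun k => (\prod_(n_ k <= s < (m_ k).+1) xs s)%g)].

End NullSequences.

Section DislocatedSpace.
Context {disp : Order.disp_t} {M : poMonoidType disp} {X : Type}.
Implicit Types (Z : set (nat -> pos M)) (d : X -> X -> pos M).
Implicit Types (x y : X) (xs : nat -> X).

Definition dislocated_distance d :=
  (forall x y, d x y = d y x) /\ (forall x y, d x y = 1%g -> x = y).

Definition converges Z d xs x := Z (fun n => d (xs n) x).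

Definition hausdorff Z d :=
  forall xs x y, converges Z d xs x -> converges Z d xs y -> x = y.

Definition cauchy_sequence Z d xs :=
  forall n_ m_ : nat -> nat, increasing n_ -> increasing m_ ->
    (forall k, (n_ k < m_ k)%N) -> Z (fun k => d (xs (n_ k)) (xs (m_ k))).

Definition H_complete Z d :=
  forall xs, cauchy_sequence Z d xs -> exists x, converges Z d xs x.

Definition CW Z d : set (nat -> X) :=
  [set xs | cauchy_series Z (fun n => d (xs n) (xs n.+1))].

Definition W_complete Z d :=
  forall xs, CW Z d xs -> exists x, converges Z d xs x.

Definition orbit_from (n : nat) (f : X -> X) x : set X :=
  [set iter m f x | m in [set m | (n <= m)%N]].

Definition full_orbit (f : X -> X) x := orbit_from 0 f x.

End DislocatedSpace.

Section OrderedSpace.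
Context {dispM : Order.disp_t} {M : poMonoidType dispM}.
Context {dispX : Order.disp_t} {X : porderType dispX}.
Implicit Types (Z : set (nat -> pos M)) (d : X -> X -> pos M).

Definition regular_convergence Z d :=
  (forall (xs : nat -> X) x, nondecreasing_sequence xs ->
     converges Z d xs x -> forall n, xs n <= x) /\
  (forall (xs : nat -> X) x y, nondecreasing_sequence xs ->
     converges Z d xs x -> (forall n, xs n <= y) -> x <= y).

Definition orbitally_semicontinuous Z d (f : X -> X) :=
  forall z x, converges Z d (fun n => iter n f z) x -> f x <= x.

End OrderedSpace.

Definition riesz_property {disp : Order.disp_t} (X : porderType disp) :=
  forall x y : X, exists z, supremums [set x; y] z.

Definition comparable_orbits {disp : Order.disp_t} {X : porderType disp}
    (f : X -> X) (u v : X) :=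
  forall x y, full_orbit f u x -> full_orbit f v y -> x >=< y.

(* lam 0 is a dummy: Lambda lam n is lam n \o ... \o lam 1, and Lambda lam 0   *)
(* is the identity.                                                            *)
Fixpoint Lambda {T : Type} (lam : nat -> T -> T) (n : nat) : T -> T :=
  if n is k.+1 then lam k.+1 \o Lambda lam k else id.

Section Conditions.
Context {dispM : Order.disp_t} {M : poMonoidType dispM} {X : Type}.
Variables (Z : set (nat -> pos M)) (d : X -> X -> pos M).
Variables (f : X -> X) (lam : nat -> pos M -> pos M).

Definition null_iterates :=
  forall a : pos M, Z (fun n => Lambda lam n.+1 a).

Definition orbit_contraction (u v : X) :=
  forall n, (0 < n)%N -> forall x y, orbit_from n f u x -> orbit_from n f v y ->
    exists x' y', [/\ orbit_from n.-1 f u x', orbit_from n.-1 f v y'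
                    & d x y <= lam n (d x' y')].

Definition orbits_bounded (u v : X) :=
  bounded [set d x y | x in full_orbit f u & y in full_orbit f v].

Definition conditions_I (x0 : X) :=
  [/\ H_complete Z d,
      bounded [set d (iter n f x0) (iter m f x0) | n in setT & m in setT],
      null_iterates
    & orbit_contraction x0 x0].

Definition conditions_II (x0 : X) :=
  [/\ W_complete Z d,
      forall n, (0 < n)%N ->
        d (iter n f x0) (iter n.+1 f x0) <=
          lam n (d (iter n.-1 f x0) (iter n f x0))
    & cauchy_series Z (fun n => Lambda lam n.+1 (d x0 (f x0)))].

Definition conditions_III :=
  [/\ null_iterates,
      forall u v, orbit_contraction u v
    & forall u v, orbits_bounded u v].

End Conditions.

Definition conditions_III_comparable {dispM dispX : Order.disp_t}
    {M : poMonoidType dispM} {X : porderType dispX}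
    (Z : set (nat -> pos M)) (d : X -> X -> pos M) (f : X -> X)
    (lam : nat -> pos M -> pos M) :=
  [/\ null_iterates Z lam,
      forall u v, comparable_orbits f u v -> orbit_contraction d f lam u v
    & forall u v, comparable_orbits f u v -> orbits_bounded d f u v].

(* Main.v *)
(** Along two orbits satisfying the contraction condition and bounded by [a],
    all distances beyond the [n]-th iterates are at most [Lambda lam n a].
    Under (I) this makes the orbit of [x0] Cauchy; under (II) the consecutive
    distances are dominated by a Cauchy series. The limit [x] satisfies
    [f x <= x] by semi-continuity, and [x <= f x] because [f x] is an upper
    bound of the nondecreasing orbit. For two fixed points the same estimate
    bounds their distance by a null sequence; in the Riesz case the orbit of
    their supremum [z <= f z] converges to both of them. *)
Require Import Defs.
From mathcomp Require Import all_boot all_order.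
From mathcomp Require Import boolp classical_sets.
Local Open Scope classical_set_scope.
Local Open Scope order_scope.

Import Order.TTheory.

Lemma pos_val_le (disp : Order.disp_t) (M : poMonoidType disp) (a b : pos M) :
  (pos_val a <= pos_val b) = (a <= b).
Proof. exact: Order.le_val. Qed.

Lemma pos_mulg_le (disp : Order.disp_t) (M : poMonoidType disp)
    (a b c e : pos M) : a <= b -> c <= e -> (a * c)%g <= (b * e)%g.
Proof. by rewrite -!pos_val_le => ab ce; apply: lem_mulg. Qed.

Lemma pos_prod_le (disp : Order.disp_t) (M : poMonoidType disp)
    (a b : nat -> pos M) (r : seq nat) :
  (forall n, a n <= b n) -> (\prod_(i <- r) a i)%g <= (\prod_(i <- r) b i)%g.
Proof.
move=> ab; elim: r => [|i r IHr]; first by rewrite !big_nil.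
by rewrite !big_cons; apply: pos_mulg_le.
Qed.

Lemma cauchy_series_le (disp : Order.disp_t) (M : poMonoidType disp)
    (Z : set (nat -> pos M)) (a b : nat -> pos M) :
  null_family Z -> (forall n, a n <= b n) ->
  cauchy_series Z b -> cauchy_series Z a.
Proof.
move=> Z_null ab bZ n_ m_ n_incr m_incr nm.
apply: (null_le Z_null (bZ _ _ n_incr m_incr nm)) => k.
exact: pos_prod_le.
Qed.

(** A bound of [N] in [M] lies above some [c] in the cone, hence lies in the cone itself, so that
    [lam] can be applied to it. *)
Lemma bounded_pos (disp : Order.disp_t) (M : poMonoidType disp)
    (N : set (pos M)) :
  N !=set0 -> bounded N -> exists b : pos M, forall a, N a -> a <= b.
Proof.
move=> [c Nc] [m ubm].
have le_m a : N a -> pos_val a <= m by move=> Na; apply: ubm; exists a.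
have m_pos : pos_pred m by apply: le_trans (le_m c Nc); case: (c).
by exists (Pos m_pos) => a Na; rewrite -pos_val_le; apply: le_m.
Qed.

Lemma iter_orbit_from (X : Type) (f : X -> X) (x : X) (n m : nat) :
  (n <= m)%N -> orbit_from n f x (iter m f x).
Proof. by move=> nm; exists m. Qed.

Lemma iter_fixed (X : Type) (f : X -> X) (x : X) (n : nat) :
  f x = x -> iter n f x = x.
Proof. by move=> fx; elim: n => //= n ->. Qed.

Lemma fixed_orbit_from (X : Type) (f : X -> X) (x y : X) (n : nat) :
  f x = x -> orbit_from n f x y -> y = x.
Proof. by move=> fx [m _ <-]; apply: iter_fixed. Qed.

(** Induction on [n]: each contraction step lowers the orbit index by one and costs one operator,
    whose monotonicity carries the bound along; at index 0 boundedness supplies [a]. *)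
Lemma orbit_contraction_le {disp : Order.disp_t} {M : poMonoidType disp}
    {X : Type} {d : X -> X -> pos M} {f : X -> X} {lam : nat -> pos M -> pos M}
    {u v : X} :
  (forall n, (0 < n)%N -> {homo lam n : a b / a <= b}) ->
  orbit_contraction d f lam u v -> orbits_bounded d f u v ->
  exists a : pos M, forall n x y,
    orbit_from n f u x -> orbit_from n f v y -> d x y <= Lambda lam n a.
Proof.
move=> lam_nondec contr bnd.
have ne : [set d x y | x in full_orbit f u & y in full_orbit f v] !=set0.
  exists (d u v); exists u; first exact: (iter_orbit_from _ _ _ 0 0).
  by exists v => //; exact: (iter_orbit_from _ _ _ 0 0).
have [a le_a] := bounded_pos _ _ _ ne bnd.
exists a; elim=> [|n IHn] x y ux vy; first by apply: le_a; exists x => //; exists y.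
have [x' [y' [ux' vy' le_d]]] := contr n.+1 isT x y ux vy.
by apply: le_trans le_d _; apply: lam_nondec => //; apply: IHn.
Qed.

Lemma iter_nondecreasing (disp : Order.disp_t) (X : porderType disp)
    (f : X -> X) (x : X) :
  {homo f : x y / x <= y} -> x <= f x ->
  nondecreasing_sequence (fun n => iter n f x).
Proof.
move=> f_nondec x_le.
apply: homo_leq => [y|y z t|n]; [exact: lexx|exact: le_trans|].
by elim: n => //= n IHn; apply: f_nondec.
Qed.

Section FixedPoints.
Context {dispM : Order.disp_t} {M : poMonoidType dispM}.
Context {Z : set (nat -> pos M)} (Z_null : null_family Z).
Context {dispX : Order.disp_t} {X : porderType dispX} {d : X -> X -> pos M}.
Context {f : X -> X} {lam : nat -> pos M -> pos M}.
Hypothesis lam_nondec : forall n, (0 < n)%N -> {homo lam n : a b / a <= b}.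

Lemma conditions_I_converges (x0 : X) : conditions_I Z d f lam x0 ->
  exists x, converges Z d (fun n => iter n.+1 f x0) x.
Proof.
case=> complete bnd null contr; apply: complete => n_ m_ n_incr m_incr nm.
have bnd' : orbits_bounded d f x0 x0.
  case: bnd => m ubm; exists m => _ [_ [_ [i _ <-] [_ [j _ <-] <-]] <-].
  by apply: ubm; exists (d (iter i f x0) (iter j f x0)) => //; exists i => //; exists j.
have [a le_a] := orbit_contraction_le lam_nondec contr bnd'.
(* The [k]-th distance is at most [Lambda lam (n_ k).+1 a], a term of a subsequence of the null
   sequence of [a]; the shift matches the orbit starting at [f x0]. *)
apply: (null_le Z_null (null_subseq Z_null (null a) n_incr)) => k.
by apply: le_a; apply: iter_orbit_from => //; rewrite ltnS ltnW.
Qed.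

Lemma conditions_II_converges (x0 : X) : conditions_II Z d f lam x0 ->
  exists x, converges Z d (fun n => iter n.+1 f x0) x.
Proof.
case=> complete contr series; apply: complete.
have le_Lambda n :
    d (iter n f x0) (iter n.+1 f x0) <= Lambda lam n (d x0 (f x0)).
  elim: n => [|n IHn]; first exact: lexx.
  by apply: le_trans (contr n.+1 isT) _; apply: lam_nondec.
by apply: cauchy_series_le series => // n; apply: le_Lambda.
Qed.

Lemma orbit_limit_fixed (x0 x : X) :
  regular_convergence Z d -> {homo f : x y / x <= y} ->
  orbitally_semicontinuous Z d f -> x0 <= f x0 ->
  converges Z d (fun n => iter n.+1 f x0) x -> f x = x.
Proof.
move=> [reg_ub reg_lub] f_nondec f_osc x0_le cvx.
have incr := iter_nondecreasing _ _ _ _ f_nondec x0_le.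
have incrS : nondecreasing_sequence (fun n => iter n.+1 f x0).
  by move=> m n mn; apply: incr; rewrite ltnS.
apply/eqP; rewrite eq_le; apply/andP; split.
  (* Semi-continuity counts iterates from 0, so it is used at [f x0], whose orbit is the shifted
     one. *)
  apply: (f_osc (f x0)).
  by rewrite (_ : (fun n => iter n f (f x0)) = (fun n => iter n.+1 f x0)) //;
     apply/funext => n; rewrite -iterSr.
apply: (reg_lub _ _ _ incrS cvx) => n.
(* The bound is [iter n.+1 f x0 <= f (iter n.+1 f x0) <= f x]. *)
apply: le_trans (incr n.+1 n.+2 (leqnSn _)) _.
exact/f_nondec/(reg_ub _ _ incrS cvx).
Qed.

(** A fixed point lies in all its own orbit tails, so the orbit estimate applies with the second
    point kept at [x]. *)
Lemma orbit_converges_fixed (u x : X) :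
  null_iterates Z lam -> f x = x ->
  orbit_contraction d f lam u x -> orbits_bounded d f u x ->
  converges Z d (fun n => iter n.+1 f u) x.
Proof.
move=> null fx contr bnd.
have [a le_a] := orbit_contraction_le lam_nondec contr bnd.
apply: (null_le Z_null (null a)) => n; apply: le_a; first exact: iter_orbit_from.
by rewrite -{2}(iter_fixed _ _ _ n.+1 fx); apply: iter_orbit_from.
Qed.

Lemma conditions_III_unique : dislocated_distance d ->
  conditions_III Z d f lam -> forall x y, f x = x -> f y = y -> y = x.
Proof.
move=> [_ d_eq] [null contr bnd] x y fx fy; apply/d_eq/(null_cst_eq Z_null).
(* The orbit of [y] is constant, so its convergence to [x] says that the constant sequence [d y x]
   is null. *)
have := orbit_converges_fixed y x null fx (contr y x) (bnd y x).
by congr (Z _); apply/funext => n; rewrite iter_fixed.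
Qed.

(** The points [x] and [y] may be incomparable, so they are compared through [z], and the Hausdorff
    property identifies the two limits of its orbit. *)
Lemma conditions_III_comparable_unique :
  hausdorff Z d -> {homo f : x y / x <= y} -> riesz_property X ->
  conditions_III_comparable Z d f lam ->
  forall x y, f x = x -> f y = y -> y = x.
Proof.
move=> hausd f_nondec riesz [null contr bnd] x y fx fy.
have [z [ub_z lub_z]] := riesz x y.
have xz : x <= z by apply: ub_z; left.
have yz : y <= z by apply: ub_z; right.
have z_le : z <= f z.
  by apply: lub_z => _ [->|->]; [rewrite -fx|rewrite -fy]; apply: f_nondec.
have incr := iter_nondecreasing _ _ _ _ f_nondec z_le.
have cvg_z w : f w = w -> w <= z -> converges Z d (fun n => iter n.+1 f z) w.
  move=> fw wz; have cmp : comparable_orbits f z w.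
    (* The orbit of [w] is just [w], which lies below [z] and hence below every iterate of [z]. *)
    move=> _ t [n _ <-] /(fixed_orbit_from _ _ _ _ _ fw) ->.
    by rewrite /Order.comparable orbC (le_trans wz (incr 0 n (leq0n n))).
  by apply: orbit_converges_fixed => //; [apply: contr|apply: bnd].
by apply: hausd; apply: cvg_z; eassumption.
Qed.

End FixedPoints.

Theorem theorem4 (dispM : Order.disp_t) (M : poMonoidType dispM)
  (Z : set (nat -> pos M)) (Z_null : null_family Z)
  (dispX : Order.disp_t) (X : porderType dispX)
  (d : X -> X -> pos M) (d_dist : dislocated_distance d)
  (X_hausdorff : hausdorff Z d) (X_regular : regular_convergence Z d)
  (f : X -> X) (f_nondec : {homo f : x y / x <= y})
  (f_osc : orbitally_semicontinuous Z d f)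
  (lam : nat -> pos M -> pos M)
  (lam_nondec : forall n, (0 < n)%N -> {homo lam n : a b / a <= b})
  (x0 : X) (x0_le : x0 <= f x0)
  (cond : conditions_I Z d f lam x0 \/ conditions_II Z d f lam x0) :
  exists x : X,
    [/\ f x = x,
        converges Z d (fun n => iter n.+1 f x0) x,
        conditions_III Z d f lam -> forall y, f y = y -> y = x
      & riesz_property X -> conditions_III_comparable Z d f lam ->
        forall y, f y = y -> y = x].
Proof.
have [x cvx] : exists x, converges Z d (fun n => iter n.+1 f x0) x.
  case: cond; first exact: conditions_I_converges.
  exact: conditions_II_converges.
have fx := orbit_limit_fixed x0 x X_regular f_nondec f_osc x0_le cvx.
exists x; split=> // [III|riesz III] y fy.
  exact: (conditions_III_unique Z_null lam_nondec d_dist III).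
exact: (conditions_III_comparable_unique
  Z_null lam_nondec X_hausdorff f_nondec riesz III).
Qed.
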